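(* Let $n\ge 1$ be an integer and let $\varphi:\mathbb{R}^n\to\mathbb{R}$ be a convex function in $E^{\mathrm{soft}}(n)$. Then: (i) $\varphi\in \mathcal{C}^1(\mathbb{R}^n)$; (ii) if, in addition, $\varphi$ has bounded sections (i.e. $S_\varphi(x,p,s)$ is a bounded set for every $x\in\mathbb{R}^n$, $p\in\partial\varphi(x)$ and $s>0$), then $\varphi$ is strictly convex.
   Context: For a convex function $\varphi:\mathbb{R}^n\to\mathbb{R}$ and $x_0\in\mathbb{R}^n$, the subdifferential is $\partial\varphi(x_0)=\{p\in\mathbb{R}^n:\ \varphi(x)\ge\varphi(x_0)+p\cdot(x-x_0)\ \ \forall x\in\mathbb{R}^n\}$. For $x_0\in\mathbb{R}^n$, $p\in\partial\varphi(x_0)$ and $s>0$, the section of $\varphi$ at $(x_0,p)$ with height $s$ is $$S_\varphi(x_0,p,s)=\{x\in\mathbb{R}^n:\ \varphi(x)-\varphi(x_0)-p\cdot(x-x_0)<s\}.$$ For $K>1$, $E^{\mathrm{soft}}(n,K)$ denotes the class of convex functions $\varphi:\mathbb{R}^n\to\mathbb{R}$ having the soft engulfing property with constant $K$: for any $x\in\mathbb{R}^n$, $p\in\partial\varphi(x)$ and $t>0$, if $y\in S_\varphi(x,p,t)$, then $x\in S_\varphi(y,q,Kt)$ for every $q\in\partial\varphi(y)$. Neither differentiability of $\varphi$ nor boundedness of its sections is required in this definition. Set $E^{\mathrm{soft}}(n)=\bigcup_{K>1}E^{\mathrm{soft}}(n,K)$. *)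

(* Defs.v *)
From HB Require Import structures.
From mathcomp Require Import all_boot all_order all_algebra.
From mathcomp Require Import all_classical all_reals all_analysis.

Set Implicit Arguments.
Unset Strict Implicit.
Unset Printing Implicit Defensive.

Import Order.TTheory GRing.Theory Num.Theory.
Import numFieldNormedType.Exports.

Local Open Scope classical_set_scope.
Local Open Scope ring_scope.

(* [dotmx] of MathComp requires a numClosedFieldType. *)
Definition dot (R : realType) (n : nat) (p v : 'rV[R]_n) : R :=
  \sum_(i < n) p 0 i * v 0 i.

Definition subdifferential (R : realType) (n : nat) (phi : 'rV[R]_n -> R)
    (x0 : 'rV[R]_n) : set 'rV[R]_n :=
  [set p | forall x, phi x >= phi x0 + dot p (x - x0)].

(* A total function of (x0, p, s): the conditions p \in subdifferential phi x0
   and 0 < s are imposed wherever sections are quantified over. *)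
Definition section (R : realType) (n : nat) (phi : 'rV[R]_n -> R)
    (x0 p : 'rV[R]_n) (s : R) : set 'rV[R]_n :=
  [set x | phi x - phi x0 - dot p (x - x0) < s].

Definition soft_engulfing (R : realType) (n : nat) (K : R)
    (phi : 'rV[R]_n -> R) : Prop :=
  forall (x p : 'rV[R]_n) (t : R), subdifferential phi x p -> 0 < t ->
  forall y : 'rV[R]_n, section phi x p t y ->
  forall q : 'rV[R]_n, subdifferential phi y q -> section phi y q (K * t) x.

Definition Esoft_const (R : realType) (n : nat) (K : R) :
    set ('rV[R]_n -> R) :=
  [set phi | convex_function setT phi /\ soft_engulfing K phi].

Definition Esoft (R : realType) (n : nat) : set ('rV[R]_n -> R) :=
  \bigcup_(K in [set K : R | 1 < K]) @Esoft_const R n K.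

(* Boundedness is for the library's norm on 'rV[R]_n, the maximum norm; the
   bounded sets are those of the Euclidean norm. *)
Definition has_bounded_sections (R : realType) (n : nat)
    (phi : 'rV[R]_n -> R) : Prop :=
  forall (x p : 'rV[R]_n) (s : R), subdifferential phi x p -> 0 < s ->
  bounded_set (section phi x p s).

Definition gradient (R : realType) (n : nat) (phi : 'rV[R]_n -> R)
    (x : 'rV[R]_n) : 'rV[R]_n :=
  \row_(i < n) 'D_(delta_mx 0 i) phi x.

Definition C1 (R : realType) (n : nat) (phi : 'rV[R]_n -> R) : Prop :=
  (forall x : 'rV[R]_n, differentiable phi x) /\ continuous (gradient phi).

Definition strictly_convex (R : realType) (n : nat)
    (phi : 'rV[R]_n -> R) : Prop :=
  forall (x y : 'rV[R]_n) (t : R), x != y -> 0 < t < 1 ->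
  phi (t *: x + (1 - t) *: y) < t * phi x + (1 - t) * phi y.

(* Main.v *)
(* Put [D_p(y, x) = phi y - phi x - p . (y - x)]; soft engulfing says
   [D_q(x, y) <= K D_p(y, x)].  For [H r = D_p(x + r v, x)] this yields
   [(2 K + 1) H r <= K H (2 r)], so [H r / r] decays geometrically along
   [r = 2^-k] and, being monotone, tends to [0].  Thus every subgradient
   (one exists by a finite dimensional Hahn-Banach argument) is the gradient,
   and convexity upgrades this to C^1.  If [phi] is not strictly convex, it is
   affine on some segment [[z, z + v]]; engulfing extends an affine piece from
   [[z, z + b v]], [b >= 1], by the fixed step [(K + 1)^-1], hence to the whole
   ray, which lies in a section and is unbounded. *)
Require Import Defs.
From mathcomp Require Import all_boot all_order all_algebra.
From mathcomp Require Import all_classical all_reals all_analysis.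
From HB Require Import structures.
From mathcomp Require Import ring lra.
Import Order.TTheory GRing.Theory Num.Theory.
Import numFieldNormedType.Exports.

(** * Linearity and continuity of [dot], and coordinates against the maximum norm *)

Section DotProduct.
Local Open Scope classical_set_scope.
Local Open Scope ring_scope.
Context {R : realType} {n : nat}.
Implicit Types p q v w : 'rV[R]_n.

Lemma dotDl p q v : dot (p + q) v = dot p v + dot q v.
Proof.
by rewrite /dot -big_split; apply: eq_bigr => i _; rewrite mxE mulrDl.
Qed.

Lemma dotZl a p v : dot (a *: p) v = a * dot p v.
Proof. by rewrite /dot mulr_sumr; apply: eq_bigr => i _; rewrite mxE mulrA. Qed.

Lemma dot_delta p i : dot p (delta_mx 0 i) = p 0 i.
Proof.
rewrite /dot (bigD1 i)//= mxE !eqxx mulr1 big1 ?addr0// => j ji.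
by rewrite mxE (negbTE ji) andbF mulr0.
Qed.

Lemma dot_deltal i v : dot (delta_mx 0 i) v = v 0 i.
Proof.
rewrite /dot (bigD1 i)//= mxE !eqxx mul1r big1 ?addr0// => j ji.
by rewrite mxE (negbTE ji) andbF mul0r.
Qed.

Lemma dot0l v : dot 0 v = 0.
Proof. by rewrite /dot big1// => i _; rewrite mxE mul0r. Qed.

Lemma dotDr p v w : dot p (v + w) = dot p v + dot p w.
Proof.
by rewrite /dot -big_split; apply: eq_bigr => i _; rewrite mxE mulrDr.
Qed.

Lemma dotZr a p v : dot p (a *: v) = a * dot p v.
Proof.
by rewrite /dot mulr_sumr; apply: eq_bigr => i _; rewrite mxE mulrCA.
Qed.

Lemma dotBr p v w : dot p (v - w) = dot p v - dot p w.
Proof. by rewrite -scaleN1r dotDr dotZr mulN1r. Qed.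

Lemma continuous_dot p : continuous (dot p : 'rV[R]_n -> R^o).
Proof.
apply: continuous_big => [|i _ x].
  exact: (@pseudometric_normed_Zmodule.add_continuous _ R^o).
by apply: cvgMr; [exact: nbhs_filter|exact: coord_continuous].
Qed.

Lemma ler_coord_norm v i : `|v 0 i| <= `|v|.
Proof.
rewrite [leRHS]/Num.norm/= mx_normrE.
exact: (le_bigmax _ (fun ij => `|v ij.1 ij.2|) (0, i)).
Qed.

End DotProduct.

(** * Convexity inequalities and existence of subgradients *)

Section ConvexFunctions.
Local Open Scope classical_set_scope.
Local Open Scope ring_scope.
Context {R : realType} {n : nat} {f : 'rV[R]_n -> R}.
Hypothesis fconv : convex_function setT f.
Implicit Types (x y v w : 'rV[R]_n) (r s t : R).

Lemma convex_functionE t x y : 0 <= t -> t <= 1 ->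
  f (t *: x + (1 - t) *: y) <= t * f x + (1 - t) * f y.
Proof.
move=> t0 t1.
have t01 : 0 <= t <= 1 by rewrite t0 t1.
pose T : {i01 R} := @Itv01 R t t0 t1.
have := fconv T x y; rewrite !in_setT => /(_ isT isT).
by [].
Qed.

Lemma convex_weighted r s x y : 0 < r -> 0 < s ->
  (r + s) * f ((r + s)^-1 *: (r *: x + s *: y)) <= r * f x + s * f y.
Proof.
move=> r0 s0; have rs0 : 0 < r + s by rewrite addr_gt0.
have rsn0 := lt0r_neq0 rs0.
have c0 : 0 <= r / (r + s) by rewrite divr_ge0// ltW.
have c1 : r / (r + s) <= 1 by rewrite ler_pdivrMr// mul1r lerDl ltW.
have := @convex_functionE (r / (r + s)) x y c0 c1.
have -> : 1 - r / (r + s) = s / (r + s) by field.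
rewrite -(ler_pM2l rs0) scalerDr !scalerA ![_^-1 * _]mulrC => fle.
apply: le_trans fle _.
by rewrite le_eqVlt; apply/orP; left; apply/eqP; field.
Qed.

(** Jensen's inequality with equal weights: the mean of the earlier points, weighted by their
    number, is combined with the last point, of weight [1]. *)
Lemma convex_mean m (u : 'I_m -> 'rV[R]_n) : (0 < m)%N ->
  m%:R * f (m%:R^-1 *: \sum_i u i) <= \sum_i f (u i).
Proof.
case: m u => // m u _; elim: m u => [|m IH] u.
  by rewrite !big_ord1 invr1 scale1r mul1r.
rewrite big_ord_recr [leRHS]big_ord_recr/=.
have {IH}IH := IH (fun i => u (widen_ord (leqnSn m.+1) i)).
apply: le_trans (lerD IH (lexx _)).
set S := \sum_(i < m.+1) _.
have := @convex_weighted m.+1%:R 1 (m.+1%:R^-1 *: S) (u ord_max).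
rewrite mul1r ltr0n ltr01 scale1r scalerA divff ?pnatr_eq0// scale1r.
by rewrite natr1; apply.
Qed.

(* One-step extension of a subgradient along the line spanned by [v], as in
   the Hahn-Banach theorem: the slope is a supremum of left difference
   quotients. *)
Lemma subgradient_extend (U : set 'rV[R]_n) x p v :
  U 0 -> (forall a b w w', U w -> U w' -> U (a *: w + b *: w')) ->
  (forall w, U w -> f x + dot p w <= f (x + w)) ->
  exists c : R, forall w s, U w -> f x + dot p w + s * c <= f (x + w + s *: v).
Proof.
move=> U0 Ulin fp.
(* Left quotients lie below right quotients: the crosswise weights [r] and [s] cancel the multiples
   of [v] and leave a point of [x + U], where [fp] applies. *)
have key w w' r s : U w -> U w' -> 0 < r -> 0 < s ->
    (f x + dot p w - f (x + w - r *: v)) / r <=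
    (f (x + w' + s *: v) - f x - dot p w') / s.
  move=> Uw Uw' r0 s0; rewrite ler_pdivrMr// mulrAC ler_pdivlMr//.
  have rs0 : 0 < r + s by rewrite addr_gt0.
  have := @convex_weighted r s (x + w' + s *: v) (x + w - r *: v) r0 s0.
  set z := _ *: (_ + _).
  have -> : z = x + ((r + s)^-1 * r *: w' + (r + s)^-1 * s *: w).
    apply: (scalerI (lt0r_neq0 rs0)); apply/rowP => i; rewrite /z !mxE.
    by field; rewrite lt0r_neq0.
  have := fp _ (Ulin ((r + s)^-1 * r) ((r + s)^-1 * s) _ _ Uw' Uw).
  rewrite -(ler_pM2l rs0) => /le_trans /[apply].
  rewrite dotDr !dotZr.
  have -> : (r + s) *
      (f x + ((r + s)^-1 * r * dot p w' + (r + s)^-1 * s * dot p w)) =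
      (r + s) * f x + r * dot p w' + s * dot p w.
    by field; rewrite lt0r_neq0.
  lra.
pose A : set R := [set a | exists w r, [/\ U w, 0 < r &
  a = (f x + dot p w - f (x + w - r *: v)) / r]].
have A0 : A !=set0.
  by eexists; exists 0, 1; split; [exact: U0|exact: ltr01|reflexivity].
have Aub w s : U w -> 0 < s ->
    ubound A ((f (x + w + s *: v) - f x - dot p w) / s).
  by move=> Uw s0 _ [w' [r [Uw' r0 ->]]]; exact: key.
exists (sup A) => w s Uw.
have [s0|s0|->] := ltgtP s 0; last by rewrite mul0r addr0 scale0r addr0 fp.
- have : (f x + dot p w - f (x + w - (- s) *: v)) / (- s) <= sup A.
    apply: ub_le_sup.
      by exists ((f (x + 0 + 1 *: v) - f x - dot p 0) / 1); exact: Aub.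
    by exists w, (- s); rewrite oppr_gt0.
  rewrite ler_pdivrMr ?oppr_gt0// scaleNr opprK; lra.
- have : sup A <= (f (x + w + s *: v) - f x - dot p w) / s.
    exact: ge_sup (Aub _ _ Uw s0).
  by rewrite ler_pdivlMr//; lra.
Qed.

(** Induction on the number [k] of leading coordinates in which [w] may be nonzero; each step
    extends the subgradient by one basis vector. *)
Lemma subdifferential_nonempty x : exists p, subdifferential f x p.
Proof.
suff H k : (k <= n)%N -> exists p, forall w,
    (forall i : 'I_n, (k <= i)%N -> w 0 i = 0) -> f x + dot p w <= f (x + w).
  have [p fp] := H n (leqnn n); exists p => y.
  rewrite -{2}[y](subrKC x); apply: fp => i; rewrite leqNgt.
  by rewrite (ltn_ord i).
elim: k => [_|k IH kn].
  exists 0 => w w0; have -> : w = 0 by apply/rowP => i; rewrite w0// mxE.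
  by rewrite dot0l !addr0.
have [p fp] := IH (ltnW kn).
pose j := Ordinal kn.
pose U : set 'rV[R]_n := [set w | forall i : 'I_n, (k <= i)%N -> w 0 i = 0].
have [||c fc] := @subgradient_extend U x p (delta_mx 0 j) _ _ fp.
- by move=> i _; rewrite mxE.
- by move=> a b w w' Uw Uw' i ki; rewrite !mxE Uw// Uw'// !mulr0 addr0.
(* The [j]-th coordinate of [p], which vectors of [U] do not see, is replaced by the slope [c]. *)
exists (p + (c - p 0 j) *: delta_mx 0 j) => w Uw.
have U' : U (w - w 0 j *: delta_mx 0 j).
  move=> i; rewrite leq_eqVlt !mxE eqxx /= => /predU1P[ki|ki].
    have -> : i = j by apply: val_inj.
    by rewrite eqxx mulr1 subrr.
  rewrite Uw// (_ : i == j = false) ?mulr0 ?subr0//.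
  by apply/negbTE; rewrite -val_eqE/= neq_ltn ki orbT.
have := fc _ (w 0 j) U'.
rewrite -[x + _ + _]addrA subrK => /(le_trans _); apply.
rewrite dotDl dotZl dot_deltal dotBr dotZr dot_delta.
by rewrite le_eqVlt; apply/orP; left; apply/eqP; ring.
Qed.

End ConvexFunctions.

(** * Differentiability from a first order expansion *)

Section Expansion.
Local Open Scope classical_set_scope.
Local Open Scope ring_scope.

(** The expansion first determines ['d f x] through [diff_unique], which does not presuppose
    differentiability; [diff_locallyP] then yields the latter. *)
Lemma differentiable_bound {R : realType} {V W : normedModType R} (f : V -> W)
    (df : {linear V -> W}) x : continuous df ->
  (forall eps, 0 < eps ->
    \forall v \near 0, `|f (x + v) - f x - df v| <= eps * `|v|) ->
  differentiable f x /\ 'd f x = df :> (V -> W).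
Proof.
move=> dfc fdf.
have expand : f \o shift x = cst (f x) + df +o_ 0 id.
  apply/eqaddoP => eps /fdf; apply: filterS => v.
  by rewrite !fctE /= [v + x]addrC opprD addrA.
have dE : 'd f x = df :> (_ -> _) by exact: diff_unique.
by split=> //; apply/diff_locallyP; rewrite dE.
Qed.

End Expansion.

(** * Soft engulfing and the decay of the Bregman gap *)

Section SoftEngulfing.
Local Open Scope classical_set_scope.
Local Open Scope ring_scope.
Context {R : realType} {n : nat} {phi : 'rV[R]_n -> R} {K : R}.
Hypotheses (phiconv : convex_function setT phi) (K1 : 1 < K)
  (phisoft : soft_engulfing K phi).
Implicit Types (x y v w p q : 'rV[R]_n) (r s t eps : R).

Lemma subgradient_le x p v t : subdifferential phi x p ->
  phi x + t * dot p v <= phi (x + t *: v).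
Proof. by move=> /(_ (x + t *: v)); rewrite [_ - x]addrC addKr dotZr. Qed.

(** Sections are strict and heights positive, so engulfing is applied at the gap plus [eps / K]; the
    excess becomes [eps], which is arbitrary. *)
Lemma soft_engulfing_le x p y q :
  subdifferential phi x p -> subdifferential phi y q ->
  phi x - phi y - dot q (x - y) <= K * (phi y - phi x - dot p (y - x)).
Proof.
move=> xp yq; have K0 := lt_trans ltr01 K1.
apply/ler_addgt0Pr => eps eps0.
have h : 0 < eps / K by exact: divr_gt0.
have xpy : phi x + dot p (y - x) <= phi y := xp y.
pose t := phi y - phi x - dot p (y - x) + eps / K.
have t0 : 0 < t by rewrite /t; lra.
have yt : section phi x p t y by rewrite /section /t /=; lra.
have := phisoft x p t xp t0 y yt q yq; rewrite /section/= => /ltW.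
by rewrite mulrDr mulrCA divff ?mulr1// gt_eqF.
Qed.

(* The engulfing inequality for [y = x + v] together with the subgradient
   inequality of a [q] at [y] tested at [x + 2 v], which eliminates [q]. *)
Lemma Bregman_halving x p v : subdifferential phi x p ->
  (2 * K + 1) * (phi (x + v) - phi x - dot p v) <=
  K * (phi (x + 2 *: v) - phi x - 2 * dot p v).
Proof.
move=> xp; have K0 := lt_trans ltr01 K1.
have [q yq] := subdifferential_nonempty phiconv (x + v).
have := soft_engulfing_le _ _ _ _ yq xp.
have -> : x - (x + v) = (-1) *: v by rewrite opprD addNKr scaleN1r.
have -> : x + v - x = v by rewrite addrAC subrr add0r.
have := subgradient_le _ _ v 1 yq; rewrite scale1r -addrA -mulr2n -scaler_nat.
rewrite dotZr -(ler_pM2l K0); lra.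
Qed.

(** Along the ray the gap is convex and vanishes at [r = 0], so its quotient by [r] is
    nondecreasing. *)
Lemma Bregman_slope_le x p v r s : subdifferential phi x p ->
  0 <= r -> r <= s -> 0 < s ->
  phi (x + r *: v) - phi x - r * dot p v <=
  r / s * (phi (x + s *: v) - phi x - s * dot p v).
Proof.
move=> xp r0 rs s0.
have c0 : 0 <= r / s by rewrite divr_ge0// ltW.
have c1 : r / s <= 1 by rewrite ler_pdivrMr// mul1r.
have := convex_functionE phiconv (r / s) (x + s *: v) x c0 c1.
have -> : (r / s) *: (x + s *: v) + (1 - r / s) *: x = x + r *: v.
  by apply/rowP => i; rewrite !mxE; field; rewrite gt_eqF.
have -> : r / s * (phi (x + s *: v) - phi x - s * dot p v) =
  r / s * phi (x + s *: v) - r / s * phi x - r * dot p v.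
  by field; rewrite gt_eqF.
by lra.
Qed.


Lemma Bregman_dyadic x p v k : subdifferential phi x p ->
  phi (x + 2^-k *: v) - phi x - 2^-k * dot p v <=
  (K / (2 * K + 1)) ^+ k * (phi (x + v) - phi x - dot p v).
Proof.
move=> xp; have K0 := lt_trans ltr01 K1.
have K21 : 0 < 2 * K + 1 by rewrite addr_gt0// mulr_gt0.
elim: k => [|k IH]; first by rewrite expr0 invr1 scale1r !mul1r.
have := Bregman_halving _ _ (2^-k.+1 *: v) xp.
have e : 2 * 2^-k.+1 = 2^-k :> R.
  by rewrite exprS invfM mulrA divff ?mul1r// pnatr_eq0.
rewrite scalerA !dotZr mulrA e => h.
rewrite -(ler_pM2l K21); apply: le_trans h _.
rewrite exprS -mulrA [leRHS]mulrA [X in _ <= X * _]mulrC divfK ?gt_eqF//.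
by rewrite ler_pM2l.
Qed.

(** Stating this for all [d] near [0] lets finitely many directions share one [d] by intersecting
    filter sets. *)
Lemma Bregman_small x p v eps : subdifferential phi x p -> 0 < eps ->
  \forall d \near 0^'+, forall r, 0 <= r <= d ->
  phi (x + r *: v) - phi x - r * dot p v <= eps * r.
Proof.
move=> xp eps0; have K0 := lt_trans ltr01 K1.
have K21 : 0 < 2 * K + 1 by rewrite addr_gt0// mulr_gt0.
set H := phi (x + v) - phi x - dot p v.
have H0 : 0 <= H.
  by have := subgradient_le _ _ v 1 xp; rewrite scale1r mul1r /H; lra.
(* Halving the step multiplies the gap by at most [K / (2 * K + 1)], hence the slope by at most [z],
   which is below [1]. *)
pose z := 2 * (K / (2 * K + 1)).
have z0 : 0 <= z by rewrite mulr_ge0// divr_ge0// ltW.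
have z1 : `|z| < 1 by rewrite ger0_norm// /z mulrA ltr_pdivrMr//; lra.
have [k zk] : exists k, z ^+ k * H <= eps.
  (* The denominator is [H + 1] because [H] may vanish. *)
  have e0 : 0 < eps / (H + 1) by rewrite divr_gt0// ltr_wpDl.
  have [k _ /(_ k (leqnn k))] := cvgr0_norm_lt _ (cvg_expr z1) _ e0.
  rewrite /= ger0_norm ?exprn_ge0// => zk; exists k.
  apply: le_trans (ler_wpM2r H0 (ltW zk)) _.
  rewrite mulrAC ler_pdivrMr ?ltr_wpDl// ler_pM2l// lerDl//.
have s0 : 0 < (2^-k : R) by rewrite invr_gt0 exprn_gt0.
near=> d => r /andP[r0 rd].
have rs : r <= 2^-k.
  apply: le_trans rd _; near: d; exact: nbhs_right_le.
apply: le_trans (Bregman_slope_le _ _ v _ _ xp r0 rs s0) _.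
apply: (@le_trans _ _ (r * (z ^+ k * H))); last by rewrite mulrC ler_wpM2r.
rewrite invrK -mulrA ler_wpM2l// /z exprMn -mulrA ler_wpM2l ?exprn_ge0//.
exact: Bregman_dyadic.
Unshelve. all: by end_near. Qed.

(* Jensen's inequality for [v = n^-1 \sum_i (n v_i) e_i] reduces the first
   order expansion at [x] to the finitely many directions [e_i] and [- e_i]. *)
Lemma Bregman_littleo x p eps : (0 < n)%N -> subdifferential phi x p ->
  0 < eps -> \forall v \near (0 : 'rV[R]_n),
  phi (x + v) - phi x - dot p v <= eps * `|v|.
Proof.
move=> n0 xp eps0; have nR : 0 < n%:R :> R by rewrite ltr0n.
have en : 0 < eps / n%:R by exact: divr_gt0.
pose P (bi : bool * 'I_n) (d : R) := forall r, 0 <= r <= d ->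
  phi (x + r *: ((-1) ^+ bi.1 *: delta_mx 0 bi.2)) - phi x
    - r * dot p ((-1) ^+ bi.1 *: delta_mx 0 bi.2) <= eps / n%:R * r.
have [d [d0 small]] : exists d : R, 0 < d /\ forall bi, P bi d.
  have /filter_ex[d [d0 dP]] : \forall d \near 0^'+, 0 < d /\ forall bi, P bi d.
    apply: filterI; first exact: nbhs_right_gt.
    have FF : Filter (0 : R)^'+ by exact: _.
    exact: (@filter_forall _ _ P _ FF (fun bi => Bregman_small x p _ _ xp en)).
  by exists d.
near=> v.
(* This bound keeps each step length, [n] times the absolute value of [v 0 i], within [d]. *)
have vd : `|v| <= d / n%:R.
  by near: v; apply: (@nbhs0_le _ 'rV[R]_n); exact: divr_gt0.
pose u i := x + (n%:R * v 0 i) *: delta_mx 0 i.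
have := convex_mean phiconv n u n0.
have -> : n%:R^-1 *: \sum_i u i = x + v.
  rewrite big_split/= sumr_const card_ord scalerDr -[x *+ n]scaler_nat.
  rewrite scalerA mulVf ?gt_eqF// scale1r scaler_sumr.
  rewrite [in RHS](row_sum_delta v); congr (_ + _).
  by apply: eq_bigr => i _; rewrite scalerA mulrA mulVf ?mul1r// gt_eqF.
have h i : phi (u i) <= phi x + n%:R * (v 0 i * p 0 i) + eps * `|v|.
  have nv : 0 <= n%:R * `|v 0 i| <= d.
    rewrite mulr_ge0//= mulrC -ler_pdivlMr//.
    exact: le_trans (ler_coord_norm v i) vd.
  (* The boolean is the sign of [v 0 i]: it selects the direction along which the step length is
     nonnegative. *)
  have := small (v 0 i < 0, i) _ nv.
  have e : n%:R * `|v 0 i| * (-1) ^+ (v 0 i < 0)%R = n%:R * v 0 i.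
    by rewrite -mulrA [`|_| * _]mulrC -numEsign.
  rewrite scalerA dotZr dot_delta mulrA e [leRHS]mulrA divfK ?gt_eqF//.
  have := ler_coord_norm v i; rewrite -(ler_pM2l eps0) /u.
  lra.
move=> /le_trans-/(_ _ (ler_sum _ (fun i _ => h i))).
rewrite !big_split/= !sumr_const card_ord -mulr_sumr.
rewrite -[phi x *+ n]mulr_natl -[_ * `|v| *+ n]mulr_natl -!mulrDr ler_pM2l//.
have -> : \sum_(i < n) v 0 i * p 0 i = dot p v.
  by apply: eq_bigr => i _; rewrite mulrC.
lra.
Unshelve. all: by end_near. Qed.

(** * Differentiability and continuity of the gradient *)

Lemma subgradient_is_diff x p : (0 < n)%N -> subdifferential phi x p ->
  differentiable phi x /\ 'd phi x = dot p :> ('rV[R]_n -> R).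
Proof.
move=> n0 xp.
have lin : linear (dot p : 'rV[R]_n -> R^o).
  by move=> a v w; rewrite dotDr dotZr.
pose L : {linear 'rV[R]_n -> R^o} :=
  HB.pack (dot p : 'rV[R]_n -> R^o) (GRing.isLinear.Build _ _ _ _ _ lin).
have Lcont : continuous L := continuous_dot p.
apply: (@differentiable_bound R _ _ (phi : _ -> R^o) L x Lcont) => eps eps0.
near=> v.
have h : phi (x + v) - phi x - dot p v <= eps * `|v|.
  by near: v; exact: Bregman_littleo.
(* The subgradient inequality makes the remainder nonnegative, so the upper bound [h] controls its
   absolute value. *)
have := subgradient_le _ _ v 1 xp; rewrite scale1r mul1r => h0.
by rewrite ger0_norm//=; lra.
Unshelve. all: by end_near. Qed.

Lemma gradient_subgradient x p : (0 < n)%N -> subdifferential phi x p ->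
  gradient phi x = p.
Proof.
move=> n0 xp; have [dphi dE] := subgradient_is_diff _ _ n0 xp.
by apply/rowP => i; rewrite mxE deriveE// dE dot_delta.
Qed.

Lemma subdifferential_gradient x : (0 < n)%N ->
  subdifferential phi x (gradient phi x).
Proof.
move=> n0; have [p xp] := subdifferential_nonempty phiconv x.
by rewrite (gradient_subgradient _ _ n0 xp).
Qed.

(** For a fixed step [r], the slope at [y] is at most the difference quotient at [y], which is close
    to the one at [x] by continuity of [phi]; the latter is within [eps / 2] of the slope at [x]. *)
Lemma gradient_upper_semicontinuous x v eps : (0 < n)%N -> 0 < eps ->
  \forall y \near x, dot (gradient phi y) v <= dot (gradient phi x) v + eps.
Proof.
move=> n0 eps0.
have phicont : continuous (phi : 'rV[R]_n -> R^o).
  move=> y; apply: differentiable_continuous.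
  exact: (subgradient_is_diff _ _ n0 (subdifferential_gradient y n0)).1.
have e2 : 0 < eps / 2 by rewrite divr_gt0.
have [r [r0 rx]] : exists r, 0 < r /\
    phi (x + r *: v) - phi x - r * dot (gradient phi x) v <= eps / 2 * r.
  have small := Bregman_small _ _ v _ (subdifferential_gradient x n0) e2.
  have FF : ProperFilter (0 : R)^'+ by exact: _.
  have /filter_ex[r [r0 rP]] :=
    @filterI _ _ FF _ _ (nbhs_right_gt (0 : R)) small.
  by exists r; split=> //; apply: rP; rewrite lexx ltW.
have e4 : 0 < eps / 4 * r by rewrite mulr_gt0// divr_gt0.
near=> y.
have := subgradient_le _ _ v r (subdifferential_gradient y n0).
have : `|phi x - phi y| <= eps / 4 * r.
  by near: y; apply: cvgr_dist_le e4; exact: phicont.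
have : `|phi (x + r *: v) - phi (y + r *: v)| <= eps / 4 * r.
  near: y; apply: cvgr_dist_le e4.
  apply: (@cvg_comp _ _ _ (fun y => y + r *: v) phi _ (nbhs (x + r *: v))).
    by apply: cvgD; [exact: cvg_id|exact: cvg_cst].
  exact: phicont.
rewrite !ler_norml => /andP[h1 h2] /andP[h3 h4] h5.
rewrite -(ler_pM2l r0). lra.
Unshelve. all: by end_near. Qed.

(** Upper semicontinuity in direction [- e_i] is lower semicontinuity in direction [e_i], and the
    maximum norm involves only these finitely many directions. *)
Lemma gradient_continuous : (0 < n)%N -> continuous (gradient phi).
Proof.
move=> n0 x; apply/(@cvgrPdist_le _ _ _ _ (nbhs_filter x)) => eps eps0.
pose P (bi : bool * 'I_n) y :=
  dot (gradient phi y) ((-1) ^+ bi.1 *: delta_mx 0 bi.2)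
    <= dot (gradient phi x) ((-1) ^+ bi.1 *: delta_mx 0 bi.2) + eps.
near=> y.
have Py : forall bi, P bi y.
  near: y; apply: (@filter_forall _ _ P _ (nbhs_filter x)) => bi.
  exact: gradient_upper_semicontinuous.
rewrite [leLHS]/Num.norm/= mx_normrE; apply: bigmax_le => [|[j i] _].
  exact: ltW.
have := Py (true, i); have := Py (false, i).
rewrite /P /= expr0 expr1 !dotZr !dot_delta (ord1 j) !mxE => h1 h2.
by rewrite ler_norml; apply/andP; split; lra.
Unshelve. all: by end_near. Qed.

Lemma soft_engulfing_C1 : (0 < n)%N -> C1 phi.
Proof.
move=> n0; split; last exact: gradient_continuous.
move=> x.
by have [] := subgradient_is_diff _ _ n0 (subdifferential_gradient x n0).
Qed.

(** * Affine rays and strict convexity *)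

(* For [w = x + s v] with [s = b + (K + 1)^-1] and a subgradient [q] at [w], let
   [H] be the Bregman gap at [w] and [m = (q - p) . v]. Engulfing gives
   [s m <= (K + 1) H] and convexity gives [(K + 1) H <= m], so [H <= 0]. *)
Lemma affine_ray_extend x p v b : subdifferential phi x p -> 1 <= b ->
  phi (x + b *: v) = phi x + b * dot p v ->
  phi (x + (b + (K + 1)^-1) *: v) = phi x + (b + (K + 1)^-1) * dot p v.
Proof.
move=> xp b1 xb; have K0 := lt_trans ltr01 K1.
have K10 : 0 < K + 1 by exact: addr_gt0.
have c0 : 0 < (K + 1)^-1 by rewrite invr_gt0.
set c := (K + 1)^-1 in c0 *; set w := x + (b + c) *: v.
have cK : (K + 1) * c = 1 by rewrite /c divff ?gt_eqF.
have [q wq] := subdifferential_nonempty phiconv w.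
have engulf : phi x - phi w + (b + c) * dot q v <=
    K * (phi w - phi x - (b + c) * dot p v).
  have := soft_engulfing_le _ _ _ _ xp wq.
  have -> : w - x = (b + c) *: v by rewrite /w addrAC subrr add0r.
  have -> : x - w = (- (b + c)) *: v by rewrite /w opprD addNKr scaleNr.
  by rewrite !dotZr mulNr opprK.
have gap0 := subgradient_le _ _ v (b + c) xp.
(* Stepping back by [c] from [w] reaches [x + b *: v], where the value of [phi] is known; this gives
   [Hm]. *)
have := subgradient_le _ _ v (- c) wq.
rewrite /w -addrA -scalerDl addrK xb -/w => back.
apply/eqP; rewrite eq_le gap0 andbT -subr_le0.
set H := phi w - phi x - (b + c) * dot p v in engulf.
set m := dot q v - dot p v.
have Hm : H <= c * m by rewrite /H /m; lra.
have mH : (b + c) * m <= (K + 1) * H by rewrite /H /m in engulf *; lra.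
have {}Hm : (K + 1) * H <= m.
  by move: Hm; rewrite -(ler_pM2l K10) mulrA cK mul1r.
have H0 : 0 <= H by rewrite /H; lra.
have m0 : 0 <= m by apply: le_trans Hm; rewrite mulr_ge0// ltW.
(* Since [b >= 1], the factor is at least [c > 0], which forces [m <= 0]. *)
have : (b + c - 1) * m <= 0 by lra.
rewrite pmulr_rle0; last by lra.
move=> m0'; have : (K + 1) * H <= 0 by lra.
by rewrite pmulr_rle0// /H; lra.
Qed.

(** The extension step does not depend on the length already reached, so iterating it goes
    arbitrarily far. *)
Lemma affine_ray x p v k : subdifferential phi x p ->
  phi (x + v) = phi x + dot p v ->
  phi (x + (1 + k%:R / (K + 1)) *: v) = phi x + (1 + k%:R / (K + 1)) * dot p v.
Proof.
move=> xp xv; have K0 := lt_trans ltr01 K1.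
elim: k => [|k IH]; first by rewrite mul0r addr0 scale1r mul1r.
rewrite -natr1 mulrDl mul1r addrA; apply: affine_ray_extend => //.
by rewrite lerDl divr_ge0// ltW// addr_gt0.
Qed.

Lemma soft_engulfing_strictly_convex :
  has_bounded_sections phi -> strictly_convex phi.
Proof.
move=> bnd x y t xy /andP[t0 t1]; rewrite ltNge; apply/negP => le.
set z := t *: x + (1 - t) *: y in le.
have [p zp] := subdifferential_nonempty phiconv z.
set v := x - z.
have yz : y - z = - (t / (1 - t)) *: v.
  by apply/rowP => i; rewrite /v /z !mxE; field; lra.
have v0 : v != 0.
  have -> : v = (1 - t) *: (x - y) by apply/rowP => i; rewrite /v /z !mxE; ring.
  by rewrite scaler_eq0 !subr_eq0 negb_or xy andbT; lra.
(* The affine support at [z] lies below [phi] at [x] and at [y]; by [le] the weighted mean of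
   [phi x] and [phi y] is at most [phi z], so there is equality at [x]. *)
have zv : phi (z + v) = phi z + dot p v.
  have hx : phi z + dot p v <= phi x := zp x.
  have : phi z + dot p (y - z) <= phi y := zp y.
  rewrite yz dotZr mulNr -(@ler_pM2l _ (1 - t)) ?subr_gt0// mulrBr.
  rewrite mulrA [_ * (t / _)]mulrC divfK ?subr_eq0 ?gt_eqF// => hy.
  have hx' : t * phi x <= t * (phi z + dot p v) by lra.
  by rewrite ler_pM2l// in hx'; rewrite /v subrKC; lra.
have [M MP] : exists M, forall w, section phi z p 1 w -> `|w| <= M.
  exact: (@filter_ex _ _ proper_pinfty_nbhs _ (bnd z p 1 zp ltr01)).
have K10 : 0 < K + 1 by rewrite addr_gt0// (lt_trans ltr01 K1).
have v0' : 0 < `|v| by rewrite normr_gt0.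
(* Chosen so that [k%:R / (K + 1)] times the norm of [v] exceeds the sum of the absolute value of
   [M] and the norm of [z]. The point [z + b *: v] has gap [0], so it lies in the section of height
   [1], yet its norm exceeds [M]. *)
pose k := Num.bound ((K + 1) * (`|M| + `|z|) / `|v|).
pose b := 1 + k%:R / (K + 1).
have : `|z + b *: v| <= M.
  apply: MP; rewrite /section/= (affine_ray _ _ _ _ zp zv).
  by rewrite [_ - z]addrC addKr dotZr -/b; lra.
have b0 : 0 <= b by rewrite addr_ge0// divr_ge0// ltW.
have : b * `|v| <= `|z + b *: v| + `|z|.
  rewrite -[X in X * _]ger0_norm// -normrZ -{1}[b *: v](addKr z) addrC.
  by rewrite -[`|z|]normrN ler_normD.
have : `|M| + `|z| < b * `|v|.
  rewrite -ltr_pdivrMr//; apply: (@lt_le_trans _ _ (k%:R / (K + 1))).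
    rewrite ltr_pdivlMr// mulrC mulrA; apply: archi_boundP.
    by rewrite divr_ge0// mulr_ge0// ?ltW// addr_ge0.
  by rewrite /b lerDr.
have := ler_norm M; lra.
Qed.

End SoftEngulfing.

Theorem theorem2p1 (R : realType) (n : nat) (hn : (1 <= n)%N)
    (phi : 'rV[R]_n -> R) (hconv : convex_function setT phi)
    (hsoft : Esoft phi) :
  C1 phi /\ (has_bounded_sections phi -> strictly_convex phi).
Proof.
have [K K1 [_ phisoft]] := hsoft.
split; first exact: soft_engulfing_C1 hconv K1 phisoft hn.
exact: soft_engulfing_strictly_convex hconv K1 phisoft.
Qed.
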